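(* Let $N\ge1$, $0\le s\le N$, $e>0$ and $d_1,\dots,d_s$ be integers such that: $e\ge N-1$; $0<d_i\le e$ for $1\le i\le s$; $\sum_{i=1}^s d_i\le e+s-1$; $s=N=e+1$ if and only if $\sum_{i=1}^s d_i=2e$; if $e\ge2$ then at most $e$ of $d_1,\dots,d_s$ are equal to $1$, and if $e=1$ then at most $2$ of them are equal to $1$. Then $$T_N(e; d_1, \dotsc, d_s) = \frac{(e-1)!}{(e+1-N)!} \binom{2e +N-s-1- \sum_{j=1}^{s} d_j}{e+N-2s} \prod_{j=1}^s d_j ,$$ with the convention $\binom{-1}{-1}=1$.
   Context: A plane tree with $e\ge1$ edges is a triple $\Gamma=(H,\alpha,\sigma)$, where $H$ is a set of $2e$ half-edges and $\alpha,\sigma$ are permutations of $H$ such that $\alpha$ is a fixed-point-free involution, the group generated by $\alpha,\sigma$ acts transitively on $H$, and $\sigma$ has exactly $e+1$ cycles (fixed points counted as cycles). Cycles of $\alpha$ are the edges, cycles of $\sigma$ are the vertices (with the cyclic order of half-edges around them), and the degree of a vertex is the length of its cycle. An $N$-rooted tree ($N\ge1$) is a plane tree together with $N$ distinct half-edges (roots) belonging to $N$ distinct cycles of $\sigma$; the corresponding $N$ vertices (root vertices) are labeled $v_1,\dots,v_N$. An isomorphism of $N$-rooted trees $(H,\alpha,\sigma)\to(H',\alpha',\sigma')$ is a bijection $\varphi:H\to H'$ with $\alpha=\varphi^{-1}\alpha'\varphi$, $\sigma=\varphi^{-1}\sigma'\varphi$, sending the $k$th root to the $k$th root for all $k$.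 Isomorphic trees are identified. $T_N(e;d_1,\dots,d_s)$, $0\le s\le N$, is the number of $N$-rooted trees with $e$ edges in which the root vertex $v_j$ has degree $d_j$ for $j=1,\dots,s$, the degrees of $v_{s+1},\dots,v_N$ being unconstrained; equivalently, it is the sum of $T_N(e;d_1,\dots,d_N)$ over all possible values of $d_{s+1},\dots,d_N$. *)

(* Defs.v *)
From mathcomp Require Import all_boot all_order all_algebra all_fingroup.

Set Implicit Arguments.
Unset Strict Implicit.
Unset Printing Implicit Defensive.

(* The permutations alpha and sigma and the N marked half-edges, as a finite
   type of triples; the tree axioms are imposed by [rooted_tree]. *)
Definition rooted_data (H : finType) (N : nat) : finType :=
  ({perm H} * {perm H} * {ffun 'I_N -> H})%type.

Definition alpha (H : finType) (N : nat) (t : rooted_data H N) : {perm H} :=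
  t.1.1.
Definition sigma (H : finType) (N : nat) (t : rooted_data H N) : {perm H} :=
  t.1.2.
Definition root (H : finType) (N : nat) (t : rooted_data H N) (k : 'I_N) : H :=
  t.2 k.

Definition plane_tree (H : finType) (e : nat) (a s : {perm H}) : bool :=
  [&& #|H| == 2 * e,
      [forall h, a (a h) == h],
      [forall h, a h != h],
      [transitive <<[set a; s]>>%g, on [set: H] | 'P]
    & #|porbits s| == e.+1].

Definition rooted_tree (H : finType) (e N : nat) (t : rooted_data H N) : bool :=
  [&& plane_tree e (alpha t) (sigma t),
      injectiveb (root t)
    & injectiveb (fun k => porbit (sigma t) (root t k))].

Definition tree_iso (H H' : finType) (N : nat)
    (t : rooted_data H N) (t' : rooted_data H' N) : bool :=
  [exists phi : {ffun H -> H'},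
    [&& injectiveb phi,
        [forall h', h' \in codom phi],
        [forall h, phi (alpha t h) == alpha t' (phi h)],
        [forall h, phi (sigma t h) == sigma t' (phi h)]
      & [forall k, phi (root t k) == root t' k]]].

Definition root_degree (H : finType) (N : nat) (t : rooted_data H N)
    (k : 'I_N) : nat :=
  #|porbit (sigma t) (root t k)|.

(* With [d = [:: d_1; ...; d_s]], the degrees of the first s root vertices are
   prescribed (indices are shifted by one) and the others are free. *)
Definition has_root_degrees (H : finType) (N : nat) (d : seq nat)
    (t : rooted_data H N) : bool :=
  [forall k : 'I_N, (k < size d) ==> (root_degree t k == nth 0 d k)].

(* T_N(e; d_1, ..., d_s): the number of isomorphism classes. Every tree with
   e edges is isomorphic to one whose set of half-edges is ['I_(2 * e)], so
   it is enough to count the classes on that carrier. *)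
Definition T (N e : nat) (d : seq nat) : nat :=
  #|equivalence_partition (@tree_iso 'I_(2 * e) 'I_(2 * e) N)
      [set t : rooted_data 'I_(2 * e) N
         | rooted_tree e t && has_root_degrees d t]|.

(* The binomial coefficient of integers: for k >= 0 it is the usual polynomial
   n (n - 1) ... (n - k + 1) / k!, which at n = - (m + 1) equals
   (-1)^k 'C(m + k, k); for k < 0 it is 0, except that (-1 choose -1) = 1. *)
Definition binz (n k : int) : int :=
  match n, k with
  | Posz n, Posz k => 'C(n, k)%:Z
  | Negz m, Posz k => ((-1) ^+ k * 'C(m + k, k)%:Z)%R
  | _, Negz _ => ((n == -1)%R && (k == -1)%R : nat)%:Z
  end.

(* Main.v *)
Require Import Defs.
From mathcomp Require Import all_boot all_order all_algebra all_fingroup.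
From mathcomp Require Import zify ring.

(** The trees are counted with labelled half-edges first. A relabelling of the
    half-edges of a rooted tree that preserves the tree and its first root is
    the identity, because the tree is connected; hence every isomorphism class
    contains (2e)! labelled trees (card_labelled_trees).

    For a fixed rotation sigma with e+1 cycles, the involutions alpha that turn
    it into a plane tree are the perfect matchings of the half-edges whose edges
    connect the cycles. There are (e-1)! times the product of the cycle lengths
    of them (card_connecting_matchings): contracting the edge at a chosen
    half-edge gives a matching with one edge and one block less, and the sum over
    its possible partners reproduces the same product formula.

    It remains to sum this product over the pairs of a sigma and N roots with
    prescribed degrees. Write M = e+1-N for the number of vertices without root.
    The product of the lengths of the rootless cycles, times M!, counts the ways
    to choose M further roots in these cycles (card_extensions). So the sum can be
    taken over pairs of a sigma and a root in every cycle, each pair weighted by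
    the product of the first N degrees only. When all e+1 cycle lengths are
    prescribed, such a pair is the same thing as an arrangement of the 2e
    half-edges in a table whose rows have these lengths, so there are (2e)! of
    them (card_cycle_systems). This gives (trees_degree_sequences)

      T_N(e; d) M! = (e-1)! sum_c c_1 c_2 .. c_N,

    where c runs over the compositions of 2e into e+1 positive parts that start
    with d. The sum is the product of the d_j times the coefficient of degree
    2e - sum d in the power series

      (x/(1-x))^M (x/(1-x)^2)^(N-s) = x^(M+N-s) / (1-x)^(M+2(N-s)),

    which is the binomial coefficient of the formula. *)

Set Implicit Arguments.
Unset Strict Implicit.
Unset Printing Implicit Defensive.

(** * Matchings that connect the blocks of a partition *)

Lemma tperm_out (T : finType) (x y z : T) :
  z != x -> z != y -> tperm x y z = z.
Proof. by move=> zx zy; rewrite tpermD // eq_sym. Qed.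

Section TreeMatchings.

Variables (H V : finType).
Implicit Types (A : {set H}) (W S : {set V}) (b : H -> V) (a : {perm H}).

(** A matching of [A] is encoded as an involution of the whole of [H] that fixes
    the complement of [A], so that deleting an edge does not change its type. *)
Definition matching A a : bool :=
  [&& perm_on A a, [forall x, a (a x) == x] & [forall x in A, a x != x]].

(** Connectedness of the graph with vertex set [W] and an edge between [b x] and
    [b (a x)] for each [x] in [A], expressed by the absence of cuts: a cut of a
    contracted graph is just a cut of the original one that does not separate
    the two merged vertices. *)
Definition connects A W b a : bool :=
  [forall S : {set V}, [forall x in A, (b (a x) \in S) == (b x \in S)] ==>
    [forall v in W, [forall w in W, (v \in S) == (w \in S)]]].

Lemma matchingP A a :
  reflect [/\ forall x, x \notin A -> a x = x, forall x, a (a x) = x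
            & forall x, x \in A -> a x != x] (matching A a).
Proof.
apply: (iffP and3P) => [[onA /forallP invol /forall_inP nofix]|
                        [outA invol nofix]]; split => //.
- by move=> x; apply: out_perm.
- by move=> x; apply/eqP.
- by apply/subsetP=> x; rewrite inE => neq; apply: contraR neq => /outA ->.
- by apply/forallP=> x; rewrite invol.
- by apply/forall_inP.
Qed.

Lemma connectsP A W b a :
  reflect (forall S, (forall x, x \in A -> (b (a x) \in S) = (b x \in S)) ->
             forall v w, v \in W -> w \in W -> (v \in S) = (w \in S))
          (connects A W b a).
Proof.
apply: (iffP forallP) => [conn S Sclosed v w vW wW | conn S].
  have /implyP/(_ _)/forall_inP/(_ v vW)/forall_inP/(_ w wW)/eqP := conn S.
  by apply; apply/forall_inP=> x xA; rewrite Sclosed.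
apply/implyP=> /forall_inP Sclosed.
apply/forall_inP=> v vW; apply/forall_inP=> w wW.
by apply/eqP/conn => // x xA; apply/eqP/Sclosed.
Qed.

Lemma matching_mem A a x : matching A a -> x \in A -> a x \in A.
Proof. by case/and3P=> onA _ _; rewrite perm_closed. Qed.

Lemma matching0 a : matching set0 a = (a == 1%g).
Proof.
apply/matchingP/eqP => [[out _ _]|->].
  by apply/permP=> x; rewrite out ?inE // perm1.
by split=> x; rewrite ?perm1 ?inE.
Qed.

(** Composing with the transposition of [h] and [k] deletes or inserts the edge
    between them; being a translation in the permutation group, it is a bijection
    between the matchings with this edge and those of the smaller set. *)
Lemma matching_remove A a h k : h \in A -> k \in A -> k != h ->
  (matching A (tperm h k * a)%g && ((tperm h k * a)%g h == k)) =
  matching (A :\ h :\ k) a.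
Proof.
move=> hA kA kh; rewrite permM tpermL.
apply/andP/matchingP => [[/matchingP[out invol nofix] /eqP ak]|
                         [out invol nofix]].
  have ah : a h = h by move: (invol h); rewrite !permM tpermL ak tpermR.
  have aE x : x != h -> x != k -> a x = (tperm h k * a)%g x.
    by move=> xh xk; rewrite permM tperm_out.
  have stay x : x != h -> x != k -> (a x != h) && (a x != k).
    by move=> xh xk; rewrite -{1}ah -{1}ak !(inj_eq perm_inj) xh xk.
  split=> x.
  - rewrite !inE !negb_and !negbK.
    have [-> | xk] := eqVneq x k => //.
    by have [-> | xh] := eqVneq x h => //= xA; rewrite aE ?out.
  - have [-> | xk] := eqVneq x k; first by rewrite !ak.
    have [-> | xh] := eqVneq x h; first by rewrite !ah.
    by have /andP[? ?] := stay x xh xk; rewrite [a (a x)]aE // aE ?invol.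
  - by rewrite !inE => /and3P[xk xh xA]; rewrite aE ?nofix.
have ak : a k = k by rewrite out // !inE eqxx.
have ah : a h = h by rewrite out // !inE eqxx andbF.
have stay x : x != h -> x != k -> (a x != h) && (a x != k).
  by move=> xh xk; rewrite -{1}ah -{1}ak !(inj_eq perm_inj) xh xk.
split; last by rewrite ak.
apply/matchingP; split=> x.
- have [-> | xk] := eqVneq x k; first by rewrite kA.
  have [-> | xh xA] := eqVneq x h; first by rewrite hA.
  by rewrite permM tperm_out // out // !inE xk xh.
- rewrite !permM; have [-> | xk] := eqVneq x k; first by rewrite tpermR ah tpermL.
  have [-> | xh] := eqVneq x h; first by rewrite tpermL ak tpermR.
  have /andP[? ?] := stay x xh xk.
  by rewrite [tperm h k x]tperm_out // tperm_out.
- rewrite permM; have [-> | xk] := eqVneq x k; first by rewrite tpermR ah eq_sym.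
  have [-> | xh xA] := eqVneq x h; first by rewrite tpermL ak.
  by rewrite tperm_out // nofix // !inE xk xh.
Qed.

(** Contraction: the half-edges of [w] are given to [v]. *)
Definition merge (v w : V) b (x : H) : V := if b x == w then v else b x.

(** No cut separates the ends of a loop, so loops can be deleted. *)
Lemma connects_loop A W b a h k : h \in A -> k \in A ->
  b k = b h -> matching (A :\ h :\ k) a ->
  connects A W b (tperm h k * a)%g -> connects (A :\ h :\ k) W b a.
Proof.
move=> hA kA bkh /matchingP[out _ _] /connectsP conn.
have ak : a k = k by rewrite out // !inE eqxx.
have ah : a h = h by rewrite out // !inE eqxx andbF.
apply/connectsP=> S Sclosed; apply: conn => x xA; rewrite permM.
case: tpermP => [-> | -> | xh xk]; rewrite ?ak ?ah ?bkh //.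
by rewrite Sclosed // !inE xA andbT; apply/andP; split; apply/eqP.
Qed.

(** The cuts that the edge between [h] and [k] does not cross are those that put
    [b h] and [b k] on the same side, that is, the cuts of the contraction. *)
Lemma connects_contract A W b a h k : h \in A -> k \in A ->
  b h \in W -> b k != b h -> matching (A :\ h :\ k) a ->
  connects A W b (tperm h k * a)%g =
  connects (A :\ h :\ k) (W :\ b k) (merge (b h) (b k) b) a.
Proof.
move=> hA kA hW bkh /matchingP[out _ _].
have ak : a k = k by rewrite out // !inE eqxx.
have ah : a h = h by rewrite out // !inE eqxx andbF.
apply/connectsP/connectsP => conn S Sclosed v w.
  rewrite !inE => /andP[vk vW] /andP[wk wW].
  pose m u := if u == b k then b h else u.
  have := conn [set u | m u \in S] _ v w vW wW.
  rewrite !inE /m (negPf vk) (negPf wk); apply=> x xA; rewrite !inE permM.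
  case: tpermP => [-> | -> | /eqP xh /eqP xk].
  - by rewrite ak eqxx eq_sym (negPf bkh).
  - by rewrite ah eqxx eq_sym (negPf bkh).
  - by apply: Sclosed; rewrite !inE xk xh.
have khS : (b k \in S) = (b h \in S).
  by have := Sclosed h hA; rewrite permM tpermL ak.
have mS x : (merge (b h) (b k) b x \in S) = (b x \in S).
  by rewrite /merge; case: eqP => // ->.
have main u : u \in W -> (u \in S) = (b h \in S).
  move=> uW; have [-> // | uk] := eqVneq u (b k).
  apply: conn; rewrite ?inE ?uk ?uW ?hW 1?eq_sym ?bkh // => x.
  rewrite !inE !mS => /and3P[xk xh xA].
  by have := Sclosed x xA; rewrite permM tperm_out.
by move=> vW wW; rewrite !main.
Qed.

Lemma card_removed A h k : h \in A -> k \in A -> k != h ->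
  #|A| = #|A :\ h :\ k|.+2.
Proof.
by move=> hA kA kh; rewrite (cardsD1 h A) hA (cardsD1 k) !inE kh kA.
Qed.

(** Deleting a loop or contracting an edge preserves connectedness, uses up two
    half-edges and loses at most one vertex. *)
Lemma connects_bound n A W b a : #|A| <= 2 * n ->
  (forall x, x \in A -> b x \in W) -> matching A a -> connects A W b a ->
  #|W| <= n.+1.
Proof.
elim: n A W b a => [|n IHn] A W b a leA bW matchA connA.
  have A0 : A = set0 by apply/eqP; rewrite -cards_eq0 -leqn0.
  apply/card_le1_eqP => v w vW wW.
  apply/eqP; have := connectsP _ _ _ _ connA [set v] _ v w vW wW.
  by rewrite !inE eqxx => eqS; rewrite -eqS // => x; rewrite A0 in_set0.
have [A0 | [h hA]] := set_0Vmem A.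
  by apply: leq_trans (IHn A W b a _ bW matchA connA) _; rewrite ?A0 ?cards0.
pose k := a h.
have kA : k \in A by apply: matching_mem hA.
have kh : k != h by case/matchingP: matchA => _ _; apply.
pose a' := (tperm h k * a)%g.
have aE : a = (tperm h k * a')%g by rewrite /a' mulgA tperm2 mul1g.
have matchA' : matching (A :\ h :\ k) a'.
  by rewrite -matching_remove // -aE matchA eqxx.
have leA' : #|A :\ h :\ k| <= 2 * n.
  by move: leA; rewrite (card_removed hA kA kh) mulnS.
rewrite aE in connA.
have [bkh | bkh] := eqVneq (b k) (b h).
  have conn' := connects_loop hA kA bkh matchA' connA.
  apply: leq_trans (IHn _ _ _ _ leA' _ matchA' conn') _ => //.
  by move=> x; rewrite !inE => /and3P[_ _ /bW].
rewrite connects_contract ?bW // in connA.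
rewrite (cardsD1 (b k)) bW // add1n ltnS.
apply: IHn leA' _ matchA' connA => x; rewrite !inE /merge => /and3P[_ _ /bW xW].
by case: (eqVneq (b x) (b k)) => [_ | ->]; rewrite ?xW // eq_sym bkh bW.
Qed.

End TreeMatchings.

Section TreeMatchingCount.

Variables (H V : finType).
Implicit Types (A : {set H}) (W S : {set V}) (b : H -> V) (a : {perm H}).

(** The matchings are sorted by the partner [k] of [h]. A partner in the block of
    [h] does not occur: it would make a loop, and the n other edges are too few to
    connect n+2 blocks. *)
Lemma card_connecting_first A W b n h : h \in A ->
  #|A| = 2 * n.+1 -> #|W| = n.+2 -> (forall x, x \in A -> b x \in W) ->
  #|[pred a | matching A a && connects A W b a]| =
  \sum_(k in A | b k != b h)
    #|[pred a | matching (A :\ h :\ k) a &&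
        connects (A :\ h :\ k) (W :\ b k) (merge (b h) (b k) b) a]|.
Proof.
move=> hA cardA cardW bW.
rewrite -sum1_card (partition_big (fun a => a h) (mem A)) /=; last first.
  by move=> a /andP[matchA _]; apply: matching_mem hA.
rewrite (bigID (fun k => b k != b h)) /= [X in (_ + X)%N]big1 ?addn0 => [|k].
  apply: eq_bigr => k /andP[kA bkh]; rewrite -sum1_card.
  have kh : k != h by apply: contraNneq bkh => ->.
  rewrite (reindex_inj (mulgI (tperm h k))) /=; apply: eq_bigl => a.
  rewrite !inE andbAC matching_remove //.
  by apply: andb_id2l => matchA; rewrite connects_contract ?bW.
case/andP=> kA /negPn/eqP bkh.
rewrite big_pred0 // => a; apply/negP => /andP[/andP[matchA connA] /eqP ahk].
have kh : k != h by rewrite -ahk; case/matchingP: matchA => _ _; apply.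
pose a' := (tperm h k * a)%g.
have aE : a = (tperm h k * a')%g by rewrite /a' mulgA tperm2 mul1g.
have matchA' : matching (A :\ h :\ k) a'.
  by rewrite -matching_remove // -aE matchA ahk eqxx.
rewrite aE in connA.
have : #|W| <= n.+1; last by rewrite cardW ltnn.
apply: connects_bound _ matchA' (connects_loop hA kA bkh matchA' connA).
  by rewrite -ltnS -ltnS -(card_removed hA kA kh) cardA mulnS.
by move=> x; rewrite !inE => /and3P[_ _ /bW].
Qed.

Definition fiber A b (v : V) : {set H} := [set x in A | b x == v].

Lemma sum_fibers A W b : (forall x, x \in A -> b x \in W) ->
  \sum_(v in W) #|fiber A b v| = #|A|.
Proof.
move=> bW; rewrite -[#|A|]sum1_card (partition_big b (mem W)) //=.
by apply: eq_bigr => v _; rewrite -sum1_card; apply: eq_bigl => x; rewrite !inE.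
Qed.

Lemma fiber_contract_other A b h k u : b k != b h -> u != b h -> u != b k ->
  fiber (A :\ h :\ k) (merge (b h) (b k) b) u = fiber A b u.
Proof.
move=> bkh uh uk; apply/setP=> x; rewrite !inE /merge.
have [->|xk] := eqVneq x k.
  by rewrite eqxx (eq_sym (b k)) (eq_sym (b h)) (negPf uh) (negPf uk) !andbF.
have [->|xh] := eqVneq x h.
  rewrite (eq_sym (b h)) (negPf bkh).
  by rewrite (eq_sym (b h)) (negPf uh) !andbF.
case: (eqVneq (b x) (b k)) => [->|//].
by rewrite !(eq_sym _ u) (negPf uh) (negPf uk).
Qed.

Lemma card_fiber_contract A b h k : h \in A -> k \in A -> b k != b h ->
  #|fiber A b (b h)| + #|fiber A b (b k)| =
  #|fiber (A :\ h :\ k) (merge (b h) (b k) b) (b h)|.+2.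
Proof.
move=> hA kA bkh; have kh : k != h by apply: contraNneq bkh => ->.
have mE x : (merge (b h) (b k) b x == b h) = (b x == b h) || (b x == b k).
  by rewrite /merge; case: (eqVneq (b x) (b k)); rewrite ?eqxx ?orbT ?orbF.
have -> : fiber (A :\ h :\ k) (merge (b h) (b k) b) (b h) =
          (fiber A b (b h) :|: fiber A b (b k)) :\ h :\ k.
  by apply/setP=> x; rewrite !inE mE -!andb_orr !andbA.
rewrite -card_removed ?inE ?hA ?kA ?eqxx ?orbT //.
rewrite -cardsUI.
suff -> : fiber A b (b h) :&: fiber A b (b k) = set0 by rewrite cards0 addn0.
apply/setP=> x; rewrite !inE; case: (eqVneq (b x) (b h)) => [->|//]; last first.
  by rewrite andbF.
by rewrite (eq_sym (b h)) (negPf bkh) !andbF.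
Qed.

(** With [n.+1] edges and [n.+2] blocks the matched blocks form a tree.
    In the induction, contracting an edge from the block v of [h] to a block w
    gives a block of size f_v + f_w - 2, and there are f_w edges of this kind, so
    the recursion requires, with P the product of f_w over the blocks w <> v,

      sum_(w <> v) P (f_v + f_w - 2) = n f_v P,

    for n+1 edges; it holds because the f_w with w <> v have sum 2(n+1) - f_v.
    The formula does not make sense without edges, so the induction starts with
    one edge. *)
Theorem card_connecting_matchings n A W b :
  #|A| = 2 * n.+1 -> #|W| = n.+2 -> (forall x, x \in A -> b x \in W) ->
  #|[pred a | matching A a && connects A W b a]| =
  n`! * \prod_(v in W) #|fiber A b v|.
Proof.
elim: n A W b => [|n IHn] A W b cardA cardW bW.
all: have [A0 | [h hA]] := set_0Vmem A; first by rewrite A0 cards0 in cardA.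
all: rewrite (card_connecting_first hA cardA cardW bW).
all: have hfib : 0 < #|fiber A b (b h)|
  by apply/card_gt0P; exists h; rewrite inE hA eqxx.
all: have sumA := sum_fibers bW.
all: rewrite (big_setD1 (b h)) ?bW //= in sumA.
all: rewrite (big_setD1 (b h)) ?bW //=.
  have : #|W :\ b h| = 1 by move: cardW; rewrite (cardsD1 (b h)) bW // add1n => -[].
  case/eqP/cards1P=> w Ww; rewrite Ww big_set1 in sumA; rewrite Ww big_set1.
  have -> : \sum_(k in A | b k != b h)
    #|[pred a | matching (A :\ h :\ k) a &&
        connects (A :\ h :\ k) (W :\ b k) (merge (b h) (b k) b) a]|
    = \sum_(k in A | b k != b h) 1.
    apply: eq_bigr => k /andP[kA bkh].
    have kh : k != h by apply: contraNneq bkh => ->.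
    have A'0 : A :\ h :\ k = set0.
      apply/eqP; rewrite -cards_eq0; move: cardA.
      by rewrite (card_removed hA kA kh) => -[->].
    rewrite A'0 -[RHS](card1 (1%g : {perm H})); apply: eq_card => a.
    rewrite !inE matching0; case: eqP => //= _.
    apply/connectsP => S _ u v uW vW; congr (_ \in S).
    have : #|W :\ b k| <= 1.
      by move: cardW; rewrite (cardsD1 (b k)) bW // add1n => -[->].
    by move/card_le1_eqP; apply.
  have -> : \sum_(k in A | b k != b h) 1 = #|fiber A b w|.
    rewrite sum1_card; apply: eq_card => k; rewrite !inE.
    apply: andb_id2l => kA; apply/idP/eqP => [bkh | ->].
      by apply/set1P; rewrite -Ww !inE bkh bW.
    by have /setD1P[] : w \in W :\ b h by rewrite Ww set11.
  rewrite fact0 mul1n; have [[-> ->] // | ->] : #|fiber A b (b h)| = 1 /\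
    #|fiber A b w| = 1 \/ #|fiber A b w| = 0 by lia.
  by rewrite muln0.
set v := b h in hfib sumA *; set W' := W :\ v in sumA *.
set f := fun u => #|fiber A b u|.
have cardW' : #|W'| = n.+2 by move: cardW; rewrite (cardsD1 v) bW // add1n => -[].
have -> : \sum_(k in A | b k != v)
    #|[pred a | matching (A :\ h :\ k) a &&
        connects (A :\ h :\ k) (W :\ b k) (merge v (b k) b) a]|
  = \sum_(k in A | b k != v)
      n`! * ((f v + f (b k) - 2) * \prod_(u in W' :\ b k) f u).
  apply: eq_bigr => k /andP[kA bkh].
  have kh : k != h by apply: contraNneq bkh => ->.
  rewrite IHn.
  - rewrite (big_setD1 v) /=; last by rewrite !inE eq_sym bkh bW.
    rewrite /f [in RHS](card_fiber_contract hA kA bkh) subSS subn1 /=.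
    have -> : W :\ b k :\ v = W' :\ b k by rewrite !setDDl setUC.
    congr (_ * (_ * _)); apply: eq_bigr => u; rewrite !inE => /and3P[uk uv _].
    by rewrite fiber_contract_other.
  - by move: cardA; rewrite (card_removed hA kA kh) [in 2 * n.+2]mulnS => -[].
  - by move: cardW; rewrite (cardsD1 (b k)) bW // add1n => -[].
  - move=> x; rewrite !inE /merge => /and3P[_ _ /bW xW].
    by case: (eqVneq (b x) (b k)) => [_ | ->]; rewrite ?xW // eq_sym bkh bW.
rewrite (partition_big b (mem W')) /=; last first.
  by move=> k /andP[kA bkv]; rewrite !inE bkv bW.
have -> : \sum_(w in W') \sum_(k | (k \in A) && (b k != v) && (b k == w))
      n`! * ((f v + f (b k) - 2) * \prod_(u in W' :\ b k) f u)
  = n`! * (\prod_(u in W') f u * \sum_(w in W') (f v + f w - 2)).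
  rewrite !big_distrr /=; apply: eq_bigr => w wW'.
  have wv : w != v by case/setD1P: wW'.
  rewrite (eq_bigr (fun=> n`! * ((f v + f w - 2) * \prod_(u in W' :\ w) f u)));
    last by move=> k /andP[_ /eqP ->].
  rewrite (eq_bigl (mem (fiber A b w))) => [|k]; last first.
    by rewrite !inE -andbA; apply: andb_id2l => _; apply: andb_idl => /eqP ->.
  rewrite sum_nat_const (big_setD1 w wW') /= mulnCA -/(f w); congr (_ * _).
  by rewrite mulnAC mulnA.
(* If all blocks other than [v] meet [A], none of the truncated differences
   [f v + f w - 2] is truncated. *)
have [f0 | fpos] := posnP (\prod_(u in W') f u).
  by rewrite -/(f v) f0 !(mul0n, muln0).
rewrite factS [_ * n`!]mulnC -[RHS]mulnA; congr (_ * _).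
rewrite mulnC mulnA; congr (_ * _).
apply: (@addIn (2 * n.+2)).
rewrite -{1}cardW' mulnC -sum_nat_const -big_split /=.
transitivity (\sum_(w in W') (f v + f w)).
  apply: eq_bigr => w wW'; rewrite subnK //.
  have : 0 < f w; last by apply: leq_add hfib.
  rewrite lt0n; apply: contraL fpos => /eqP fw0.
  by rewrite (big_setD1 w) //= fw0 mul0n.
rewrite big_split /= sum_nat_const cardW' -cardA -sumA mulSn.
by rewrite [RHS]addnA [f v + _]addnC.
Qed.

End TreeMatchingCount.

(** * Transitivity and connectedness *)

Section Connectedness.

Variable H : finType.
Implicit Types (a s : {perm H}) (X : {set H}).

(** Transitivity, too, is used in the form of the absence of cuts. The base point
    [x0] serves to exclude the empty set, on which no action is transitive. *)
Lemma transitive_closedP a s (x0 : H) :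
  reflect (forall X, (forall x, (a x \in X) = (x \in X)) ->
             (forall x, (s x \in X) = (x \in X)) ->
             forall x y, (x \in X) = (y \in X))
          [transitive <<[set a; s]>>%g, on [set: H] | 'P].
Proof.
apply: (iffP idP) => [trG X Xa Xs x y | closedT].
  have sGN : <<[set a; s]>>%g \subset 'N(X | 'P)%g.
    rewrite gen_subG; apply/subsetP=> g /set2P[] ->; apply/astabsP => z.
      exact: Xa.
    exact: Xs.
  have [g gG ->] := atransP2 trG (in_setT y) (in_setT x).
  by rewrite (astabs_act _ (subsetP sGN g gG)).
apply/imsetP; exists x0; rewrite ?inE //; apply/esym/setP => y; rewrite inE.
rewrite -(closedT (orbit 'P <<[set a; s]>>%g x0) _ _ x0) ?orbit_refl // => x.
  by rewrite -[a x]/('P%act x a) orbit_actr // mem_gen // !inE eqxx.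
by rewrite -[s x]/('P%act x s) orbit_actr // mem_gen // !inE eqxx orbT.
Qed.

(** A set of half-edges stable under [s] is a union of cycles of [s], hence the
    same thing as a set of vertices. *)
Lemma transitive_connects a s (x0 : H) :
  [transitive <<[set a; s]>>%g, on [set: H] | 'P] =
  connects setT (porbits s) (porbit s) a.
Proof.
apply/(transitive_closedP _ _ x0)/connectsP => [closedT S Sa v w | conn X Xa Xs x y].
  case/imsetP=> x _ -> /imsetP[y _ ->].
  have := closedT [set z | porbit s z \in S] _ _ x y; rewrite !inE; apply=> z.
    by rewrite !inE Sa ?inE.
  by rewrite !inE -[s z]/((s ^+ 1)%g z) porbit_perm.
have XE z : (porbit s z \in porbit s @: X) = (z \in X).
  apply/imsetP/idP => [[z' z'X /eqP] | zX]; last by exists z.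
  rewrite eq_porbit_mem => /porbitP[i ->].
  by elim: i => [|i IHi]; rewrite ?expg0 ?perm1 // expgSr permM Xs.
rewrite -!XE; apply: conn; rewrite ?imset_f // => z _.
by rewrite !XE.
Qed.

End Connectedness.

(** * Permutations with a root in every cycle *)

Section CycleSystems.

Lemma porbit_expg_inj (H : finType) (s : {perm H}) (x : H) (i k : nat) :
  i < #|porbit s x| -> k < #|porbit s x| ->
  (s ^+ i)%g x = (s ^+ k)%g x -> i = k.
Proof.
move=> ltin ltkn; rewrite !permX -(nth_traject s ltin) -(nth_traject s ltkn) => /eqP.
by rewrite nth_uniq ?size_traject ?uniq_traject_porbit // => /eqP.
Qed.

Variables (J H : finType) (c : J -> nat).
Hypothesis c_gt0 : forall j, 0 < c j.
Hypothesis sum_c : \sum_j c j = #|H|.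

Implicit Types p q : {perm H} * {ffun J -> H}.

Definition cycle_system (p : {perm H} * {ffun J -> H}) : bool :=
  injectiveb (fun j => porbit p.1 (p.2 j)) &&
  [forall j, #|porbit p.1 (p.2 j)| == c j].

(** The cells of a table with one row of length [c j] for each [j]. A bijection
    from the cells to [H] lists each cycle in a row, starting with its root. *)
Definition cell : finType := {j : J & 'I_(c j)}.

Definition next_cell (u : cell) : cell :=
  Tagged (fun j => 'I_(c j)) (ordS (tagged u)).

Lemma next_cell_inj : injective next_cell.
Proof.
move=> [j i] [j' i'] eq_next.
have jj' : j = j' := congr1 tag eq_next.
case: j' / jj' i' eq_next => i' /eqP.
by rewrite eq_Tagged /= (inj_eq (@ordS_inj _)) => /eqP ->.
Qed.

Lemma card_cell : #|cell| = #|H|.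
Proof.
rewrite card_tagged sumnE big_map -sum_c big_enum.
by apply: eq_bigr => j _; rewrite card_ord.
Qed.

Definition layout (p : {perm H} * {ffun J -> H}) : {ffun cell -> H} :=
  [ffun u : cell => (p.1 ^+ (tagged u))%g (p.2 (tag u))].

Lemma cycle_systemP p :
  reflect [/\ injective (fun j => porbit p.1 (p.2 j))
            & forall j, #|porbit p.1 (p.2 j)| = c j] (cycle_system p).
Proof.
apply: (iffP andP) => [[/injectiveP ? /forallP cp] | [? cp]]; split=> //.
- by move=> j; apply/eqP.
- exact/injectiveP.
- by apply/forallP=> j; apply/eqP.
Qed.

Lemma layout_inj p : cycle_system p -> injective (layout p).
Proof.
case/cycle_systemP=> injp cp [j i] [j' i']; rewrite !ffunE /= => eq_l.
have jj' : j = j'.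
  by apply: injp; rewrite -(porbit_perm _ i) eq_l porbit_perm.
case: j' / jj' i' eq_l => i' eq_l; congr Tagged; apply: val_inj.
by apply: porbit_expg_inj eq_l; rewrite cp ltn_ord.
Qed.

Lemma layout_next p u :
  cycle_system p -> layout p (next_cell u) = p.1 (layout p u).
Proof.
case/cycle_systemP=> _ cp; case: u => j i; rewrite !ffunE /=.
rewrite -permM -expgSr; have := ltn_ord i; rewrite leq_eqVlt => /predU1P[->|lt].
  by rewrite modnn -[in RHS]cp expg0 perm1 permX iter_porbit.
by rewrite modn_small.
Qed.

(** The layout is injective, and there are as many cells as elements of [H]. *)
Lemma layout_onto p h : cycle_system p -> exists u, h = layout p u.
Proof.
move/layout_inj/inj_card_onto => /(_ _ h)/codomP; apply.
by rewrite card_cell.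
Qed.

Lemma layout_inj_in : {in cycle_system &, injective layout}.
Proof.
move=> p q /= Dp Dq eq_l.
have eq_r : p.2 = q.2.
  apply/ffunP=> j; have := congr1 (fun f : {ffun cell -> H} =>
     f (Tagged (fun j => 'I_(c j)) (Ordinal (c_gt0 j)))) eq_l.
  by rewrite !ffunE /= !expg0 !perm1.
have eq_s : p.1 = q.1.
  apply/permP=> h; have [u ->] := layout_onto h Dp.
  by rewrite -layout_next // eq_l layout_next.
by case: p q eq_r eq_s {Dp Dq eq_l} => [? ?] [? ?] /= -> ->.
Qed.

(** A filling of the table is the layout of the permutation that moves every entry
    one step along its row, with the first column as roots. *)
Lemma layout_image (f : {ffun cell -> H}) : injective f ->
  exists2 p, cycle_system p & f = layout p.
Proof.
move=> injf; have [|g fK gK] := inj_card_bij injf; first by rewrite card_cell.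
have injs : injective (f \o next_cell \o g).
  exact: inj_comp (inj_comp injf next_cell_inj) (can_inj gK).
pose z j := Tagged (fun j => 'I_(c j)) (Ordinal (c_gt0 j)).
pose p := (perm injs, [ffun j => f (z j)]).
have powE j i : (p.1 ^+ i)%g (p.2 j) =
    f (Tagged (fun j => 'I_(c j)) (Ordinal (ltn_pmod i (c_gt0 j)))).
  elim: i => [|i IHi].
    by rewrite expg0 perm1 ffunE; congr (f (Tagged _ _)); apply: val_inj; rewrite /= mod0n.
  rewrite expgSr permM IHi permE /= fK; congr (f (Tagged _ _)).
  by apply: val_inj; rewrite /= -addn1 modnDml addn1.
have fE u : f u = (p.1 ^+ (tagged u))%g (p.2 (tag u)).
  rewrite powE; case: u => j i; congr (f (Tagged _ _)); apply: val_inj.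
  by rewrite /= modn_small.
exists p; last by apply/ffunP=> u; rewrite ffunE fE.
apply/cycle_systemP; split=> [j j' /eqP | j].
  rewrite eq_porbit_mem => /porbitP[i]; rewrite powE ffunE => /injf.
  by move/(congr1 tag).
have inj_fj : injective (fun i => f (Tagged (fun j => 'I_(c j)) (i : 'I_(c j)))).
  by move=> i i' /injf/eqP; rewrite eq_Tagged => /eqP.
rewrite -[RHS]card_ord -(card_imset _ inj_fj).
apply: eq_card => y; apply/porbitP/imsetP => [[i ->] | [i _ ->]].
  by rewrite powE; exists (Ordinal (ltn_pmod i (c_gt0 j))).
by exists i; rewrite /= fE.
Qed.

(** Layouts identify the cycle systems with the bijections from the cells to
    [H]. *)
Theorem card_cycle_systems : #|cycle_system| = #|H|`!.
Proof.
rewrite -(card_in_imset layout_inj_in) -ffactnn -{2}card_cell -card_inj_ffuns.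
apply: eq_card => f; rewrite inE; apply/imsetP/injectiveP => [[p Dp ->] | injf].
  exact: layout_inj.
by have [p Dp ->] := layout_image injf; exists p.
Qed.

End CycleSystems.

(** * Isomorphism classes and labelled trees *)

Local Notation root := Defs.root.

Section Relabelling.

Variables (H : finType) (N : nat).
Implicit Types (t : rooted_data H N) (phi psi : {perm H}).

Definition relabel phi t : rooted_data H N :=
  ((alpha t ^ phi)%g, (sigma t ^ phi)%g, [ffun k => phi (root t k)]).

Lemma relabel1 t : relabel 1 t = t.
Proof.
case: t => [[a s] r]; rewrite /relabel /alpha /sigma /= !conjg1; congr (_, _).
by apply/ffunP=> k; rewrite ffunE perm1.
Qed.

Lemma relabelM phi psi t : relabel (phi * psi) t = relabel psi (relabel phi t).
Proof.
rewrite /relabel /alpha /sigma /= !conjgM; congr (_, _).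
by apply/ffunP=> k; rewrite /root /= !ffunE permM.
Qed.

Lemma tree_isoP t t' :
  reflect (exists phi, t' = relabel phi t) (tree_iso t t').
Proof.
apply: (iffP existsP) => [[f /and5P[/injectiveP injf _]] | [phi ->]].
  move=> /forallP fa /forallP fs /forallP fr; exists (perm injf).
  have conjE (u u' : {perm H}) : (forall h, f (u h) == u' (f h)) ->
      u' = (u ^ perm injf)%g.
    move=> fu; apply/permP=> h; rewrite -[h](permKV (perm injf)) permJ.
    by rewrite !permE (eqP (fu _)).
  rewrite /relabel -(conjE _ _ fa) -(conjE _ _ fs).
  case: t' {fa fs conjE} fr => [[a' s'] r'] fr; congr (_, _).
  by apply/ffunP=> k; rewrite ffunE permE (eqP (fr k)).
exists (finfun phi); apply/and5P; split.
- by apply/injectiveP=> x y; rewrite !ffunE => /perm_inj.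
- apply/forallP=> h; apply/codomP; exists (phi^-1 h)%g.
  by rewrite ffunE permKV.
- by apply/forallP=> h; rewrite !ffunE permJ.
- by apply/forallP=> h; rewrite !ffunE permJ.
- by apply/forallP=> k; rewrite /root !ffunE.
Qed.

Lemma porbit_conj (s : {perm H}) phi x :
  porbit (s ^ phi) (phi x) = phi @: porbit s x.
Proof.
apply/setP=> y; apply/porbitP/imsetP => [[i ->] | [z /porbitP[i ->] ->]].
  by exists ((s ^+ i)%g x); rewrite ?mem_porbit // -conjXg permJ.
by exists i; rewrite -conjXg permJ.
Qed.

Lemma card_porbits_conj (s : {perm H}) phi :
  #|porbits (s ^ phi)| = #|porbits s|.
Proof.
rewrite -(card_imset (porbits s) (imset_inj (@perm_inj _ phi))).
apply: eq_card => B; apply/imsetP/imsetP => [[x _ ->] | [_ /imsetP[x _ ->] ->]].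
  by exists (porbit s (phi^-1 x)%g); rewrite ?imset_f // -porbit_conj permKV.
by exists (phi x); rewrite ?porbit_conj.
Qed.

Lemma transitive_conj (a s : {perm H}) phi (x0 : H) :
  [transitive <<[set a; s]>>%g, on [set: H] | 'P] ->
  [transitive <<[set a ^ phi; s ^ phi]>>%g, on [set: H] | 'P].
Proof.
move/(transitive_closedP _ _ x0) => closedT.
apply/(transitive_closedP _ _ x0) => X Xa Xs x y.
rewrite -[x](permKV phi) -[y](permKV phi).
have := closedT (phi @^-1: X) _ _ (phi^-1 x)%g (phi^-1 y)%g.
by rewrite !inE; apply=> z; rewrite !inE -permJ.
Qed.

Lemma rooted_tree_relabel e phi t : 0 < N ->
  rooted_tree e t -> rooted_tree e (relabel phi t).
Proof.
move=> N_gt0 /and3P[/and5P[cardH /forallP invol /forallP nofix trans cyc]].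
move=> /injectiveP injr /injectiveP injo.
apply/and3P; split.
- apply/and5P; split=> //.
  + by apply/forallP=> h; rewrite -[h](permKV phi) !permJ (eqP (invol _)).
  + by apply/forallP=> h; rewrite -[h](permKV phi) permJ (inj_eq perm_inj).
  + exact: transitive_conj (root t (Ordinal N_gt0)) trans.
  + by rewrite card_porbits_conj.
- by apply/injectiveP=> k l; rewrite /root !ffunE => /perm_inj/injr.
- apply/injectiveP=> k l; rewrite /root !ffunE !porbit_conj.
  by move/(imset_inj perm_inj)/injo.
Qed.

Lemma has_root_degrees_relabel d phi t :
  has_root_degrees d (relabel phi t) = has_root_degrees d t.
Proof.
apply: eq_forallb => k; rewrite /root_degree /root ffunE porbit_conj.
by rewrite card_imset //; apply: perm_inj.
Qed.

(** When two relabellings produce the same tree, the set on which they agree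
    contains a root and is stable under [alpha] and [sigma]. *)
Lemma relabel_free e phi psi t : 0 < N -> rooted_tree e t ->
  relabel phi t = relabel psi t -> phi = psi.
Proof.
move=> N_gt0 /andP[/and5P[_ _ _ trans _] _] [eq_a eq_s eq_r].
apply/permP=> x; apply/eqP; set r0 := root t (Ordinal N_gt0).
have closedT := transitive_closedP _ _ r0 trans [set z | phi z == psi z].
have step (u : {perm H}) : (u ^ phi = u ^ psi)%g ->
    forall z, (u z \in [set z | phi z == psi z]) = (z \in [set z | phi z == psi z]).
  move=> eq_u z; rewrite !inE -(permJ u phi) -(permJ u psi) eq_u.
  by rewrite (inj_eq perm_inj).
have := closedT (step _ eq_a) (step _ eq_s) x r0; rewrite !inE => ->.
by move/ffunP/(_ (Ordinal N_gt0)): eq_r; rewrite !ffunE => ->.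
Qed.

(** The isomorphism classes are the orbits of the symmetric group of [H], which
    acts freely on rooted trees. *)
Theorem card_labelled_trees e (D : {set rooted_data H N}) : 0 < N ->
  (forall t, t \in D -> rooted_tree e t) ->
  (forall phi t, t \in D -> relabel phi t \in D) ->
  #|D| = #|equivalence_partition (@tree_iso H H N) D| * #|H|`!.
Proof.
move=> N_gt0 Dtree Dlabel.
have isoE : {in D & &, equivalence_rel (@tree_iso H H N)}.
  move=> t u v tD uD vD; split; first by apply/tree_isoP; exists 1%g; rewrite relabel1.
  case/tree_isoP=> phi ->; apply/tree_isoP/tree_isoP => [[psi ->] | [psi ->]].
    by exists (phi^-1 * psi)%g; rewrite -relabelM mulKVg.
  by exists (phi * psi)%g; rewrite relabelM.
apply: card_uniform_partition (equivalence_partitionP isoE) => B.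
case/imsetP=> t tD ->.
have relabel_inj : injective (relabel^~ t).
  by move=> phi psi; apply: relabel_free N_gt0 (Dtree t tD).
have SymT : Sym [set: H] = [set: {perm H}].
  by apply/setP=> phi; rewrite !inE; apply/subsetP=> x; rewrite inE.
rewrite -[#|H|]cardsT -card_Sym SymT -(card_imset _ relabel_inj).
apply: eq_card => t'; rewrite !inE; apply/andP/imsetP => [[_] | [phi _ ->]].
  by case/tree_isoP=> phi ->; exists phi.
by split; [apply: Dlabel | apply/tree_isoP; exists phi].
Qed.

End Relabelling.

(** * Labelled rooted trees *)

Section Transversals.

Variables (H V I : finType) (b : H -> V) (W : {set V}).

Lemma card_lifts (g : I -> V) :
  #|[pred r : {ffun I -> H} | [forall i, b (r i) == g i]]| =
  \prod_i #|[set x | b x == g i]|.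
Proof.
transitivity #|family (fun i => mem [set x | b x == g i])|.
  apply: eq_card => r; rewrite inE; apply/forallP/familyP => rg i.
    by have := rg i; rewrite inE.
  by have := rg i; rewrite inE.
rewrite card_family foldrE big_map big_enum.
by apply: eq_bigr => i _; apply: eq_card => x; rewrite !inE.
Qed.

(** First choose which index goes to which element of [W], then lift. *)
Lemma card_transversals : #|I| = #|W| ->
  #|[pred r : {ffun I -> H} |
      injectiveb (fun i => b (r i)) && [forall i, b (r i) \in W]]| =
  #|I|`! * \prod_(v in W) #|[set x | b x == v]|.
Proof.
move=> cardI; rewrite -sum1_card.
pose inj_on := [set g in ffun_on (mem W) | injectiveb (g : {ffun I -> V})].
rewrite (partition_big (fun r : {ffun I -> H} => [ffun i => b (r i)]) (mem inj_on)) /=.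
  have -> : #|I|`! = #|inj_on|.
    by rewrite card_inj_ffuns_on -ffactnn {1}cardI; congr (_ ^_ _); apply: eq_card.
  rewrite -sum_nat_const.
  apply: eq_bigr => g; rewrite inE => /andP[/ffun_onP gW /injectiveP injg].
  have imgW : g @: I = W.
    by apply/eqP; rewrite eqEcard card_imset // cardI leqnn andbT;
      apply/subsetP=> _ /imsetP[i _ ->].
  rewrite -imgW big_imset /=; last by move=> i k _ _; apply: injg.
  rewrite -(card_lifts g) -sum1_card; apply: eq_bigl => r; rewrite !inE.
  apply/andP/forallP => [[_ /eqP <-] i | rg]; first by rewrite ffunE.
  have eq_g : [ffun i => b (r i)] = g.
    by apply/ffunP=> i; rewrite ffunE (eqP (rg i)).
  split; last by apply/eqP.
  apply/andP; split; first by apply/injectiveP=> i k; rewrite !(eqP (rg _)) => /injg.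
  by apply/forallP=> i; rewrite (eqP (rg i)) imset_f.
move=> r /andP[/injectiveP injr /forallP rW]; rewrite inE; apply/andP; split.
  by apply/ffun_onP=> i; rewrite ffunE; apply: rW.
by apply/injectiveP=> i k; rewrite !ffunE => /injr.
Qed.

End Transversals.

Section RootedCount.

Variables (H : finType) (N M e : nat) (d : seq nat).
Hypothesis cardH : #|H| = 2 * e.
Hypothesis e_gt0 : 0 < e.
Hypothesis NM : N + M = e.+1.
Implicit Types (s : {perm H}) (r : {ffun 'I_N -> H}).

Local Notation slot := ('I_N + 'I_M)%type.

Definition degrees_ok (deg : 'I_N -> nat) : bool :=
  [forall k : 'I_N, (k < size d) ==> (deg k == nth 0 d k)].

(** The conditions on a rooted tree that do not involve [alpha]. *)
Definition rooted_vertices (p : {perm H} * {ffun 'I_N -> H}) : bool :=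
  [&& #|porbits p.1| == e.+1, injectiveb (fun k => porbit p.1 (p.2 k))
    & degrees_ok (fun k => #|porbit p.1 (p.2 k)|)].

(** The same with a root at each of the e+1 vertices; the degree conditions still
    concern the first roots only. *)
Definition fully_rooted_vertices (p : {perm H} * {ffun slot -> H}) : bool :=
  [&& #|porbits p.1| == e.+1, injectiveb (fun j => porbit p.1 (p.2 j))
    & degrees_ok (fun k => #|porbit p.1 (p.2 (inl k))|)].

Lemma fiber_porbit s v : v \in porbits s -> [set x | porbit s x == v] = v.
Proof.
case/imsetP=> y _ ->; apply/setP=> x.
by rewrite inE eq_porbit_mem.
Qed.

Lemma sum_porbits s : \sum_(v in porbits s) #|v| = #|H|.
Proof.
rewrite -cardsT -(@sum_fibers _ _ setT (porbits s) (porbit s)).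
  apply: eq_bigr => v vs; rewrite -{1}(fiber_porbit vs).
  by apply: eq_card => x; rewrite !inE.
by move=> x _; apply: imset_f.
Qed.

Lemma card_plane_trees s : #|porbits s| = e.+1 ->
  #|[pred a | plane_tree e a s]| = e.-1`! * \prod_(v in porbits s) #|v|.
Proof.
move=> cyc; have [x0 _] : exists x0 : H, x0 \in H.
  by apply/card_gt0P; rewrite cardH muln_gt0.
rewrite (_ : \prod_(v in porbits s) #|v| =
             \prod_(v in porbits s) #|fiber setT (porbit s) v|); last first.
  apply: eq_bigr => v vs; rewrite -{1}(fiber_porbit vs).
  by apply: eq_card => x; rewrite !inE.
rewrite -card_connecting_matchings ?prednK ?cardsT //; last first.
  by move=> x _; apply: imset_f.
apply: eq_card => a; rewrite !inE /plane_tree cardH cyc !eqxx andbT /=.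
rewrite (transitive_connects _ _ x0) andbA; congr (_ && _).
apply/andP/matchingP => [[/forallP invol /forallP nofix]|[_ invol nofix]].
  by split=> x; rewrite ?inE // (eqP (invol x)).
by split; apply/forallP=> x; rewrite ?invol ?nofix ?inE.
Qed.

Lemma card_rooted_trees :
  #|[set t : rooted_data H N | rooted_tree e t && has_root_degrees d t]| =
  \sum_(p | rooted_vertices p) e.-1`! * \prod_(v in porbits p.1) #|v|.
Proof.
rewrite -sum1_card (partition_big (fun t => (sigma t, t.2)) rooted_vertices) /=.
  apply: eq_bigr => -[s r] /and3P[/eqP cyc /= injr degr].
  rewrite -(card_plane_trees cyc) -sum1_card.
  rewrite (reindex_onto (fun a => ((a, s), r) : rooted_data H N) (fun t => alpha t)).
    apply: eq_bigl => a; rewrite !inE /rooted_tree /alpha /sigma /= !eqxx !andbT.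
    rewrite -andbA -[RHS]andbT; congr (_ && _).
    apply/andP; split=> //; apply/andP; split=> //.
    by apply/injectiveP=> k l /(congr1 (porbit s)) /(injectiveP _ injr).
  by move=> [[a s'] r'] /andP[_ /eqP[<- <-]].
move=> [[a s] r]; rewrite inE => /andP[/and3P[/and5P[_ _ _ _ cyc] _ injr] degr].
exact/and3P.
Qed.

Definition join_roots r (r' : {ffun 'I_M -> H}) : {ffun slot -> H} :=
  [ffun j => match j with inl k => r k | inr m => r' m end].

(** The M further roots form a labelled transversal of the cycles that contain
    none of the given roots. *)
Lemma card_extensions s r : rooted_vertices (s, r) ->
  \prod_k #|porbit s (r k)| *
  #|[pred r' : {ffun 'I_M -> H} |
      injectiveb (fun j => porbit s (join_roots r r' j))]| =
  M`! * \prod_(v in porbits s) #|v|.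
Proof.
case/and3P=> /eqP /= cyc /injectiveP injr _.
pose roots := [set porbit s (r k) | k : 'I_N].
pose W := porbits s :\: roots.
have rootsS : roots \subset porbits s.
  by apply/subsetP=> _ /imsetP[k _ ->]; apply: imset_f.
have cardW : #|'I_M| = #|W|.
  by rewrite cardsDS // cyc card_imset // !card_ord -NM addKn.
have -> : \prod_(v in porbits s) #|v| =
    \prod_k #|porbit s (r k)| * \prod_(v in W) #|v|.
  rewrite (big_setID roots) /= (setIidPr rootsS); congr (_ * _).
  by rewrite big_imset //= => k l _ _ /injr.
rewrite mulnCA; congr (_ * _).
rewrite (eq_bigr (fun v => #|[set x | porbit s x == v]|)); last first.
  by move=> v /setDP[vs _]; rewrite fiber_porbit.
rewrite -[M in M`!]card_ord -card_transversals //; apply: eq_card => r'; rewrite !inE.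
apply/injectiveP/andP => [injq | [/injectiveP injr' /forallP r'W]].
  split.
    apply/injectiveP=> m l eq_m.
    by have := injq (inr m) (inr l); rewrite !ffunE => /(_ eq_m) [].
  apply/forallP=> m; rewrite !inE imset_f // andbT.
  apply/imsetP=> -[k _ eq_k].
  by have := injq (inr m) (inl k); rewrite !ffunE => /(_ eq_k).
have noroot m k : porbit s (r' m) <> porbit s (r k).
  move=> eq_m; have := r'W m; rewrite eq_m inE => /andP[/negP[]].
  exact: imset_f.
move=> [k|m] [l|m']; rewrite !ffunE.
- by move/injr ->.
- by move/esym/noroot.
- by move/noroot.
- by move/injr' ->.
Qed.

(** Grouping the right-hand side by the first N roots turns it into a sum of the
    products evaluated by card_extensions. *)
Lemma sum_rooted_vertices :
  \sum_(p | rooted_vertices p) M`! * \prod_(v in porbits p.1) #|v| =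
  \sum_(p | fully_rooted_vertices p) \prod_(k < N) #|porbit p.1 (p.2 (inl k))|.
Proof.
rewrite [RHS](partition_big (fun p : {perm H} * {ffun slot -> H} =>
  (p.1, [ffun k => p.2 (inl k)])) rooted_vertices) /=.
  apply: eq_bigr => -[s r] sr; rewrite -(card_extensions sr).
  rewrite -sum1_card big_distrr /=.
  rewrite (reindex_onto (fun r2 : {ffun 'I_M -> H} => (s, join_roots r r2))
    (fun p : {perm H} * {ffun slot -> H} => [ffun m => p.2 (inr m)])) /=.
    apply: eq_big => [r2 | r2 _].
      have -> : [ffun m => join_roots r r2 (inr m)] = r2.
        by apply/ffunP=> m; rewrite !ffunE.
      have -> : [ffun k => join_roots r r2 (inl k)] = r.
        by apply/ffunP=> k; rewrite !ffunE.
      rewrite !eqxx !andbT inE /fully_rooted_vertices /=.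
      case/and3P: sr => /= -> _ degr.
      rewrite [degrees_ok _](_ : _ = true) ?andbT // -[RHS]degr.
      by apply: eq_forallb => k; rewrite ffunE.
    by rewrite muln1; apply: eq_bigr => k _; rewrite ffunE.
  move=> [s' q] /andP[_ /eqP[-> <-]]; congr (_, _); apply/ffunP=> -[k|m].
    by rewrite !ffunE.
  by rewrite !ffunE.
move=> [s q] /and3P[/= cyc /injectiveP injq degr]; apply/and3P; split=> //=.
  by apply/injectiveP=> k l; rewrite !ffunE => /injq [].
by apply: etrans degr; apply: eq_forallb => k; rewrite ffunE.
Qed.

(** The bound [2 * e] on the parts only makes the type of compositions finite. *)
Definition degree_sequence (c : {ffun slot -> 'I_(2 * e).+1}) : bool :=
  [&& [forall j, 0 < c j], \sum_j c j == 2 * e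
    & degrees_ok (fun k => c (inl k))].

(** The cycles through the roots are disjoint, so their lengths add up to the size
    of [H] exactly when there is no other cycle. *)
Lemma cycle_system_porbits s (q : {ffun slot -> H}) :
  injective (fun j => porbit s (q j)) ->
  (#|porbits s| == e.+1) = (\sum_j #|porbit s (q j)| == #|H|).
Proof.
move=> injq; set img := [set porbit s (q j) | j : slot].
have imgS : img \subset porbits s.
  by apply/subsetP=> _ /imsetP[k _ ->]; apply: imset_f.
have -> : \sum_j #|porbit s (q j)| = \sum_(v in img) #|v|.
  by rewrite big_imset //= => k l _ _ /injq.
have cardJ : #|img| = e.+1.
  by rewrite card_imset // card_sum !card_ord.
have := sum_porbits s; rewrite (big_setID img) /= (setIidPr imgS) => <-.
rewrite -{1}[\sum_(v in img) _]addn0 eqn_add2l.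
rewrite [RHS]eq_sym sum_nat_eq0 -cardJ.
rewrite eq_sym eqn_leq (subset_leq_card imgS) /=.
have [imgE _] := subset_leqif_cards imgS.
apply/idP/forall_inP => [leS v | noout].
  have /eqP <- : img == porbits s by rewrite eqEcard imgS leS.
  by rewrite setDv inE.
rewrite subset_leq_card //; apply/subsetP=> v vs; apply: contraT => vi.
have := noout v; rewrite inE vi vs => /(_ isT).
case/imsetP: vs => x _ ->; rewrite cards_eq0 => /eqP/setP/(_ x).
by rewrite porbit_id inE.
Qed.

(** Grouped by the sequence of cycle lengths, all groups have the same size
    (2e)!, by card_cycle_systems. *)
Lemma sum_fully_rooted_vertices :
  \sum_(p | fully_rooted_vertices p) \prod_(k < N) #|porbit p.1 (p.2 (inl k))| =
  (2 * e)`! * \sum_(c | degree_sequence c) \prod_(k < N) (c (inl k) : nat).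
Proof.
pose lengths (p : {perm H} * {ffun slot -> H}) : {ffun slot -> 'I_(2 * e).+1} :=
  [ffun j => inord #|porbit p.1 (p.2 j)|].
have lengthsE p j : lengths p j = #|porbit p.1 (p.2 j)| :> nat.
  by rewrite ffunE inordK // ltnS -cardH max_card.
rewrite (partition_big lengths degree_sequence) /=.
  rewrite big_distrr /=; apply: eq_bigr => c /and3P[/forallP c_gt0 /eqP sum_c deg_c].
  have sum_cH : \sum_j c j = #|H| by rewrite sum_c cardH.
  have -> : (2 * e)`! = #|@cycle_system _ H (fun j => c j)|.
    by rewrite (card_cycle_systems c_gt0 sum_cH) cardH.
  rewrite -sum_nat_const.
  apply: eq_big => [p | p /andP[_ /eqP <-]]; last first.
    by apply: eq_bigr => k _; rewrite lengthsE.
  apply/andP/cycle_systemP => [[/and3P[_ /injectiveP injp _] /eqP <-] | [injp cp]].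
    by split=> // j; rewrite lengthsE.
  split; last by apply/eqP/ffunP=> j; apply: val_inj; rewrite /= lengthsE cp.
  apply/and3P; split; [|exact/injectiveP|].
    by rewrite (cycle_system_porbits injp) (eq_bigr _ (fun j _ => cp j)) sum_cH.
  by apply: etrans deg_c; apply: eq_forallb => k; rewrite cp.
move=> p /and3P[cyc /injectiveP injp degp]; apply/and3P; split.
- apply/forallP=> j; rewrite lengthsE; apply/card_gt0P.
  by exists (p.2 j); apply: porbit_id.
- move: cyc; rewrite (cycle_system_porbits injp) cardH => /eqP sumE.
  by apply/eqP; rewrite -[RHS]sumE; apply: eq_bigr => j _; rewrite lengthsE.
- by apply: etrans degp; apply: eq_forallb => k; rewrite lengthsE.
Qed.

End RootedCount.

(** Equate two counts of the labelled rooted trees: by isomorphism class, and by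
    the pair of [sigma] and the roots. *)
Theorem trees_degree_sequences (N M e : nat) (d : seq nat) :
  0 < N -> 0 < e -> N + M = e.+1 ->
  T N e d * M`! =
  e.-1`! * \sum_(c | @degree_sequence N M e d c) \prod_(k < N) (c (inl k) : nat).
Proof.
move=> N_gt0 e_gt0 NM; have cardH : #|'I_(2 * e)| = 2 * e by rewrite card_ord.
set D := [set t : rooted_data 'I_(2 * e) N | rooted_tree e t && has_root_degrees d t].
have labelled : #|D| = T N e d * (2 * e)`!.
  rewrite -[in (2 * e)`!]cardH.
  apply: (@card_labelled_trees _ _ e _ N_gt0) => [t | phi t].
    by rewrite inE => /andP[].
  rewrite !inE => /andP[treet degt].
  by rewrite (rooted_tree_relabel _ N_gt0 treet) has_root_degrees_relabel.
apply/eqP; rewrite -(eqn_pmul2r (fact_gt0 (2 * e))) mulnAC -labelled.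
rewrite (card_rooted_trees _ _ cardH e_gt0) -mulnA [X in _ == _ * X]mulnC.
rewrite -(sum_fully_rooted_vertices _ cardH NM) -(sum_rooted_vertices _ _ NM).
rewrite mulnC !big_distrr /=.
by apply/eqP/eq_bigr => p _; rewrite mulnCA.
Qed.

(** * Sums over degree sequences *)

Import GRing.Theory Num.Theory.

Section DegreeGeneratingFunctions.

Local Open Scope ring_scope.

Variable L : nat.
Implicit Types (p : {poly int}) (t a b : nat).

(** Truncation of x/(1-x), the generating function of the degree of a vertex
    without root. The coefficients of degree at most L of a product with it are
    those of the power series. *)
Definition free_degrees : {poly int} := \poly_(i < L.+1) (0 < i)%N%:R.

(** Truncation of x/(1-x)^2: a vertex of degree i has i possible roots. *)
Definition rooted_degrees : {poly int} := \poly_(i < L.+1) i%:R.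

Lemma coef_free_degreesM p t : (t <= L)%N ->
  (free_degrees * p)`_t = \sum_(j < t) p`_j.
Proof.
move=> tL; rewrite coefMr big_ord_recr /= subnn coef_poly mul0r addr0.
apply: eq_bigr => j _; rewrite coef_poly ltnS (leq_trans (leq_subr _ _) tL).
by rewrite subn_gt0 ltn_ord mul1r.
Qed.

Lemma coef_rooted_degreesM p t : (t <= L)%N ->
  (rooted_degrees * p)`_t = \sum_(j < t) (t - j)%:R * p`_j.
Proof.
move=> tL; rewrite coefMr big_ord_recr /= subnn coef_poly mul0r addr0.
by apply: eq_bigr => j _; rewrite coef_poly ltnS (leq_trans (leq_subr _ _) tL).
Qed.

(** Up to degree L, multiplying [free_degrees] by 1-x gives x. *)
Lemma coef_free_degreesS p t : (t < L)%N ->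
  (free_degrees * p)`_t.+1 = (free_degrees * p)`_t + p`_t.
Proof.
by move=> tL; rewrite !coef_free_degreesM ?(ltnW tL) // big_ord_recr.
Qed.

(** Up to degree L, multiplying [rooted_degrees] by 1-x gives [free_degrees]. *)
Lemma coef_rooted_degreesS p t : (t < L)%N ->
  (rooted_degrees * p)`_t.+1 =
  (rooted_degrees * p)`_t + (free_degrees * p)`_t.+1.
Proof.
move=> tL; rewrite coef_free_degreesM // !coef_rooted_degreesM ?(ltnW tL) //.
rewrite !big_ord_recr /= subSnn mul1r addrA; congr (_ + _).
rewrite -big_split; apply: eq_bigr => j _ /=.
by rewrite subSn ?(ltnW (ltn_ord j)) // -natr1 mulrDl mul1r.
Qed.

Lemma coef_free_degreesX a t : (t < L)%N ->
  (free_degrees ^+ a.+1)`_t.+1 = 'C(t, a)%:R.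
Proof.
elim: a t => [|a IHa] t tL.
  by rewrite expr1 coef_poly ltnS tL bin0.
rewrite exprS; elim: t tL => [|t IHt] tL.
  by rewrite coef_free_degreesM // big_ord1 exprS coef_free_degreesM // big_ord0.
by rewrite coef_free_degreesS // IHt ?(ltnW tL) // IHa ?(ltnW tL) // binS natrD.
Qed.

(** The coefficient of x^(t+1) in x^(a+b) / (1-x)^(a+2b). Multiplication by 1-x
    makes this Pascal's rule. *)
Lemma coef_degrees a b t : (t < L)%N -> (0 < a + b)%N ->
  (free_degrees ^+ a * rooted_degrees ^+ b)`_t.+1 =
  'C(t + b, (a + 2 * b).-1)%:R.
Proof.
elim: b a t => [|b IHb] a t tL ab_gt0.
  rewrite expr0 mulr1 addn0 muln0 addn0.
  by case: a ab_gt0 => // a _; apply: coef_free_degreesX.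
have step u : (u < L)%N ->
    (free_degrees ^+ a * rooted_degrees ^+ b.+1)`_u.+1 =
    (free_degrees ^+ a * rooted_degrees ^+ b.+1)`_u +
    'C(u + b, a + 2 * b)%:R.
  move=> uL; rewrite exprS mulrCA coef_rooted_degreesS //.
  by congr (_ + _); rewrite mulrA -exprS IHb.
have -> : (a + 2 * b.+1).-1 = (a + 2 * b).+1 by lia.
elim: t tL => [|t IHt] tL; rewrite step //.
  rewrite exprS mulrCA coef_rooted_degreesM // big_ord0 add0r.
  by rewrite !add0n binS (@bin_small b (a + 2 * b).+1) //; lia.
by rewrite IHt ?(ltnW tL) // -natrD -addSnnS addnS binS.
Qed.

End DegreeGeneratingFunctions.

Section DegreeSequences.

Variables (N M e : nat) (d : seq nat).
Hypothesis sizeN : size d <= N.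
Hypothesis d_le : forall k, k < size d -> nth 0 d k <= 2 * e.

Local Notation slot := ('I_N + 'I_M)%type.

(** The weight of degree [i] at a vertex. For a root of unconstrained degree the
    factor [i] already excludes degree 0. *)
Definition slot_weight (j : slot) (i : nat) : nat :=
  match j with
  | inl k => if k < size d then (i == nth 0 d k) * i else i
  | inr _ => 0 < i
  end.

Lemma prod_slot_weight (c : {ffun slot -> 'I_(2 * e).+1}) :
  \prod_j slot_weight j (c j) =
  if [forall j, 0 < c j] && degrees_ok d (fun k => c (inl k))
  then \prod_(k < N) (c (inl k) : nat) else 0.
Proof.
case: ifP => [/andP[/forallP c_gt0 /forallP deg_c] | /negbT].
  rewrite big_sumType /= [X in _ * X]big1 ?muln1 => [|m _]; last by rewrite c_gt0.
  apply: eq_bigr => k _; have := deg_c k.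
  by case: ifP => //= _ ->; rewrite mul1n.
rewrite negb_and => bad; apply/eqP; rewrite -leqn0 leqNgt; apply/negP.
move=> w_gt0; have w_pos j : 0 < slot_weight j (c j).
  by move: w_gt0; rewrite (bigD1 j) //= muln_gt0 => /andP[].
case/orP: bad => /forallPn[j /negP[]].
  case: j (w_pos j) => [k|m] /=; last by case: (c _ : nat).
  by case: ifP => // _; rewrite muln_gt0 => /andP[].
by apply/implyP=> ltk; have := w_pos (inl j); rewrite /= ltk muln_gt0; case: eqP.
Qed.

Local Open Scope ring_scope.

(** Expanding the product over the vertices of the generating functions of their
    weights. *)
Lemma sum_degree_sequences :
  (\sum_(c | @degree_sequence N M e d c) \prod_(k < N) (c (inl k) : nat))%N%:R =
  (((\prod_(k < size d) nth 0 d k)%N%:R)%:P * 'X^(\sum_(k < size d) nth 0 d k)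
   * (free_degrees (2 * e) ^+ M * rooted_degrees (2 * e) ^+ (N - size d)))`_(2 * e).
Proof.
pose W (j : slot) : {poly int} :=
  \sum_(i < (2 * e).+1) ((slot_weight j i)%:R)%:P * 'X^i.
have Wfree m : W (inr m) = free_degrees (2 * e).
  rewrite /free_degrees poly_def; apply: eq_bigr => i _.
  by rewrite mul_polyC.
have Wroot (k : 'I_N) : W (inl k) = if (k < size d)%N
    then ((nth 0%N d k)%:R)%:P * 'X^(nth 0%N d k) else rooted_degrees (2 * e).
  rewrite /W /=; case: ifP => [ltk | _].
    have dk : (nth 0 d k < (2 * e).+1)%N by rewrite ltnS d_le.
    rewrite (bigD1 (Ordinal dk)) //= eqxx mul1n big1 ?addr0 // => i neq.
    by rewrite (_ : (i == nth 0 d k :> nat) = false) ?mul0n ?mul0r //; apply/negbTE.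
  rewrite /rooted_degrees poly_def; apply: eq_bigr => i _.
  by rewrite mul_polyC.
transitivity ((\prod_j W j)`_(2 * e)).
  rewrite bigA_distr_bigA coef_sum natr_sum [LHS]big_mkcond /=.
  apply: eq_bigr => c _; rewrite big_split /= -rmorph_prod -natr_prod prod_slot_weight.
  rewrite -expr_sum coefCM coefXn /degree_sequence andbCA [in RHS]eq_sym.
  case: (_ == _); rewrite ?mulr0 //= mulr1.
  by case: ifP.
congr ((polyseq _)`_ _); rewrite big_sumType /=.
rewrite [X in _ * X](eq_bigr _ (fun m _ => Wfree m)) prodr_const card_ord.
rewrite [X in X * _](eq_bigr _ (fun k _ => Wroot k)) mulrC [RHS]mulrCA; congr (_ * _).
rewrite -(big_mkord xpredT (fun k => if (k < size d)%N
    then ((nth 0%N d k)%:R)%:P * 'X^(nth 0%N d k) else rooted_degrees (2 * e))).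
rewrite (@big_cat_nat _ _ _ (size d)) //= big_mkord; congr (_ * _).
  rewrite natr_prod rmorph_prod expr_sum -big_split /=.
  by apply: eq_bigr => k _; rewrite ltn_ord.
rewrite (eq_big_nat _ _ (F2 := fun=> rooted_degrees (2 * e))) => [|k /andP[le _]].
  by rewrite prodr_const_nat.
by rewrite ltnNge le.
Qed.

End DegreeSequences.

(** * The number of rooted trees *)

Local Open Scope ring_scope.

Theorem proposition1 (N s e : nat) (d : s.-tuple nat)
    (hN : (1 <= N)%N) (hs : (s <= N)%N) (he : (0 < e)%N)
    (heN : (N - 1 <= e)%N)
    (hd : forall i : 'I_s, (0 < tnth d i <= e)%N)
    (hsum : (\sum_(i < s) tnth d i <= e + s - 1)%N)
    (hmax : (s = N /\ N = (e + 1)%N) <-> (\sum_(i < s) tnth d i)%N = (2 * e)%N)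
    (hones : (2 <= e)%N -> (#|[set i : 'I_s | tnth d i == 1%N]| <= e)%N)
    (hones1 : e = 1%N -> (#|[set i : 'I_s | tnth d i == 1%N]| <= 2)%N) :
  (T N e d)%:R =
    (e - 1)`!%:R / (e + 1 - N)`!%:R
    * (binz ((2 * e)%:Z + N%:Z - s%:Z - 1 - \sum_(j < s) (tnth d j)%:Z)
            (e%:Z + N%:Z - 2 * s%:Z))%:~R
    * \prod_(j < s) (tnth d j)%:R :> rat.
Proof.
set M := (e + 1 - N)%N; have NM : (N + M = e.+1)%N by rewrite /M; lia.
have nthE (j : 'I_s) : nth 0%N d j = tnth d j by rewrite (tnth_nth 0%N).
have sizeN : (size d <= N)%N by rewrite size_tuple.
have d_le k : (k < size d)%N -> (nth 0%N d k <= 2 * e)%N.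
  rewrite size_tuple => lt; have /andP[_ le] := hd (Ordinal lt).
  by rewrite (nthE (Ordinal lt)); apply: leq_trans le _; lia.
have [D DE] : {D | (\sum_(i < s) tnth d i)%N = D} by eexists.
have [K [binK sumK]] : exists K : nat,
    binz ((2 * e)%:Z + N%:Z - s%:Z - 1 - \sum_(j < s) (tnth d j)%:Z)
         (e%:Z + N%:Z - 2 * s%:Z) = K%:Z /\
    (\sum_(c | @degree_sequence N M e d c) \prod_(k < N) (c (inl k) : nat) =
     (\prod_(j < s) tnth d j) * K)%N.
  have := sum_degree_sequences M sizeN d_le.
  rewrite size_tuple -mulrA coefCM coefXnM.
  rewrite !(eq_bigr _ (fun j _ => nthE j)) DE => sumE.
  rewrite -(big_morph Posz PoszD (erefl _)) DE.
  have DL : (D <= 2 * e)%N by lia.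
  move: sumE; rewrite ltnNge DL /=.
  have [t tE] : exists t, (2 * e - D = t)%N by eexists.
  rewrite tE; case: t tE => [|t] tE.
    have [sN NE] : s = N /\ N = (e + 1)%N by apply/hmax; lia.
    have -> : M = 0%N by lia.
    (* Every vertex has a prescribed degree and nothing is left to choose; this is
       the case of the convention that -1 over -1 is 1. *)
    have -> : (N - s = 0)%N by lia.
    rewrite !expr0 mulr1 coef1 mulr1 => /eqP; rewrite eqr_nat => /eqP sumE.
    exists 1%N; rewrite muln1; split=> //.
    have -> : (2 * e)%:Z + N%:Z - s%:Z - 1 - D%:Z = -1 by lia.
    by have -> : e%:Z + N%:Z - 2 * s%:Z = -1 by lia.
  have MN : (0 < M + (N - s))%N.
    rewrite lt0n; apply/eqP=> MN0.
    have : D = (2 * e)%N by rewrite -DE; apply/hmax; lia.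
    lia.
  rewrite coef_degrees //; last by lia.
  rewrite -natrM => /eqP; rewrite eqr_nat => /eqP sumE.
  exists 'C(t + (N - s), (M + 2 * (N - s)).-1)%N; split=> //.
  have -> : (2 * e)%:Z + N%:Z - s%:Z - 1 - D%:Z = (t + (N - s))%N%:Z by lia.
  by have -> : e%:Z + N%:Z - 2 * s%:Z = (M + 2 * (N - s)).-1%:Z by lia.
have := trees_degree_sequences d hN he NM; rewrite sumK => /(congr1 (fun n => n%:R : rat)).
rewrite binK !natrM subn1 natr_prod => TM.
have M0 : M`!%:R != 0 :> rat by rewrite pnatr_eq0 -lt0n fact_gt0.
apply: (mulIf M0); rewrite TM -/M.
by field.
Qed.
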